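(* For any non-real complex number $z=a+bi$ ($a,b\in\mathbb{R}$), $\Pi[z]$ is a field of degree $2$ over the field $X=X[z]$, generated over $X$ by $bi$. The field $X=\Pi[z]\cap\mathbb{R}$ is either $\mathbb{Q}(a,b^2)$ or $\mathbb{Q}(a,b)$. The non-real complex number $z$ is Thalian if and only if $b\in\mathbb{Q}(a,b^2)$.
   Context: All constructions take place in the plane $\mathbb{C}=\mathbb{R}^2$. One considers pairs $(S,L)$, with $S\subseteq\mathbb{C}$ a set of points (the constructible points) and $L$ a set of straight lines in $\mathbb{C}$ (the constructible lines). The Thalian axioms are: (1) The line through two (distinct) constructible points is constructible. (2) The point of intersection of two (distinct, non-parallel) constructible lines is constructible. (3) The perpendicular bisector of the segment connecting two (distinct) constructible points is constructible. For a non-real $z\in\mathbb{C}$, $\Pi[z]$ is the set of points of the smallest pair $(S,L)$ with $0,1,z\in S$ closed under (1)-(3). $X[z]\subset\mathbb{R}$ is the set of $x$-coordinates (real parts) of points of $\Pi[z]$. A non-real complex number $z$ is called Thalian if $i\in\Pi[z]$. *)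

(* Defs.v *)
From mathcomp Require Import all_boot all_order all_algebra.
From mathcomp Require Import complex.
From mathcomp Require Import boolp classical_sets reals.
Set Implicit Arguments.
Unset Strict Implicit.
Unset Printing Implicit Defensive.
Import Order.TTheory GRing.Theory Num.Theory.
Local Open Scope classical_set_scope.
Local Open Scope ring_scope.
Local Open Scope complex_scope.

Section SubsetFields.
Variable F : fieldType.
Implicit Types (A K L : set F) (n : nat).

Definition is_subfield K : Prop := divring_closed (fun x => x \in K).

(* In characteristic 0 this is the field usually written Q(A). *)
Definition field_gen A : set F := smallest is_subfield A.

Definition adjoin K (x : F) : set F := field_gen (K `|` [set x]).

Definition is_basis K L n (e : 'I_n -> F) : Prop :=
  [/\ forall c : 'I_n -> F, (forall i, K (c i)) -> L (\sum_i c i * e i),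
      forall w, L w -> exists2 c : 'I_n -> F,
        (forall i, K (c i)) & w = \sum_i c i * e i
    & forall c : 'I_n -> F, (forall i, K (c i)) ->
        \sum_i c i * e i = 0 -> forall i, c i = 0].

Definition field_ext_degree K L n : Prop :=
  [/\ is_subfield K, is_subfield L, K `<=` L
    & exists e : 'I_n -> F, is_basis K L e].

End SubsetFields.

Section Thalian.
Variable R : realType.
Implicit Types (p q d w z : R[i]) (l m : set R[i]).
Implicit Types (S : set R[i]) (L : set (set R[i])).

Definition line p d : set R[i] := [set p + t%:C * d | t in [set: R]].

Definition is_line l : Prop := exists p d, d != 0 /\ l = line p d.

Definition parallel l m : Prop :=
  exists p q d, [/\ d != 0, l = line p d & m = line q d].

Definition line_through p q : set R[i] := line p (q - p).

(* Multiplication by 0 +i* 1 is the rotation by a right angle. *)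
Definition perp_bisector p q : set R[i] := line ((p + q) / 2) ((0 +i* 1) * (q - p)).

Definition thalian_closed S L : Prop :=
  [/\ L `<=` is_line,
      forall p q, S p -> S q -> p <> q -> L (line_through p q),
      forall l m w, L l -> L m -> l <> m -> ~ parallel l m ->
        l w -> m w -> S w
    & forall p q, S p -> S q -> p <> q -> L (perp_bisector p q)].

Definition thalian_pair z S L : Prop :=
  [/\ thalian_closed S L, S 0, S 1 & S z].

Definition Pi z : set R[i] := [set w | forall S L, thalian_pair z S L -> S w].

Definition Pi_lines z : set (set R[i]) :=
  [set l | forall S L, thalian_pair z S L -> L l].

Definition real_parts z : set R := [set complex.Re w | w in Pi z].

Definition Thalian z : Prop := z \isn't Num.real /\ Pi z (0 +i* 1).

Lemma full_pair z : thalian_pair z setT is_line.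
Proof.
split=> //; split=> // p q _ _ /eqP pq.
  by exists p, (q - p); rewrite subr_eq0 eq_sym.
exists ((p + q) / 2), ((0 +i* 1) * (q - p)); split => //.
rewrite mulf_neq0 ?subr_eq0 //; last by rewrite eq_sym.
by rewrite eq_complex /= eqxx oner_eq0.
Qed.

Lemma Pi_pair z : thalian_pair z (Pi z) (Pi_lines z).
Proof.
split; last 3 first; try by move=> S L [].
split.
- by move=> l /(_ _ _ (full_pair z)).
- by move=> p q Sp Sq pq S L h; case: (h) => -[_ h1 _ _] _ _ _; apply: h1 => //;
    [apply: Sp h | apply: Sq h].
- move=> l m w Ll Lm lm np lw mw S L h; case: (h) => -[_ _ h2 _] _ _ _.
  by apply: (h2 l m) => //; [apply: Ll h | apply: Lm h].
- by move=> p q Sp Sq pq S L h; case: (h) => -[_ _ _ h3] _ _ _; apply: h3 => //;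
    [apply: Sp h | apply: Sq h].
Qed.

Lemma Pi_least z S L : thalian_pair z S L -> Pi z `<=` S /\ Pi_lines z `<=` L.
Proof. by move=> h; split=> [w|l] /(_ _ _ h). Qed.

End Thalian.

(* Main.v *)
(** Let b = Im z. Midpoints and joins already yield parallels, so the points of
    a Thalian pair containing 0, 1, z form an additive group, their real members
    form a field F, and the group is F + F p for each of its non-real members p.
    Perpendicularity enters through circumcentres: those of the triangles
    0, 1, p and 0, -1, p add up to i |p|^2 / Im p. With p = z this gives a
    vertical direction, hence Re z and b i; with p = 1 + b i it gives b^2.
    Conversely, for K = Q(Re z, b^2), the set K + K b i and the lines with base
    point and direction in it form a Thalian pair, because i (x + y b i) is
    proportional to - y b^2 + x b i. Hence Pi[z] = K + K b i and always X = K;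
    the alternative X = Q(a, b) occurs only when it coincides with K. *)

Require Import Defs.
From mathcomp Require Import all_boot all_order all_algebra.
From mathcomp Require Import complex.
From mathcomp Require Import boolp classical_sets reals.
From mathcomp Require Import ring.
Set Implicit Arguments.
Unset Strict Implicit.
Unset Printing Implicit Defensive.
Import Order.TTheory GRing.Theory Num.Theory.
Local Open Scope classical_set_scope.
Local Open Scope ring_scope.
Local Open Scope complex_scope.

Ltac by_parts := apply/eqP; rewrite eq_complex /=; apply/andP; split; apply/eqP.

(** * Directions of lines and the real determinant *)

Section Lines.
Variable R : realType.
Implicit Types (p q u v w x : R[i]) (r s t k : R).

(** The imaginary part of the conjugate of [u] times [v]; it vanishes exactly when [u] and [v] are
    dependent over the reals. *)
Definition det u v : R := complex.Re u * complex.Im v - complex.Im u * complex.Re v.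

Lemma detB u v w : det u (v - w) = det u v - det u w.
Proof. by case: u v w => [a b] [c d] [e f]; rewrite /det /=; ring. Qed.

Lemma detBl u v w : det (u - v) w = det u w - det v w.
Proof. by case: u v w => [a b] [c d] [e f]; rewrite /det /=; ring. Qed.

Lemma detZ k u v : det u (k%:C * v) = k * det u v.
Proof. by case: u v => [a b] [c d]; rewrite /det /=; ring. Qed.

Lemma detC u v : det u v = - det v u.
Proof. by rewrite /det; ring. Qed.

Lemma detvv u : det u u = 0.
Proof. by rewrite /det; ring. Qed.

Lemma det1 u : det 1 u = complex.Im u.
Proof. by rewrite /det /=; ring. Qed.

Lemma det_eq0P u v : u != 0 -> det u v = 0 -> exists k, v = k%:C * u.
Proof.
case: u v => [a b] [c d]; rewrite eq_complex /= negb_and /det /= => nz /eqP.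
rewrite subr_eq0 => /eqP h; have [a0|a0] := eqVneq a 0.
  move: nz h; rewrite a0 eqxx mul0r /= => b0 /esym/eqP.
  rewrite mulf_eq0 (negPf b0) /= => /eqP ->.
  by exists (d / b); by_parts; field.
exists (c / a); by_parts; first by field.
by apply: (mulfI a0); rewrite h; field.
Qed.

(** Both [q] and [q + v] lie on the first line, so their difference is a real multiple of [u]. *)
Lemma line_eq_dir p q u v : line p u = line q v -> det u v = 0.
Proof.
move=> e; have: line q v q by exists 0 => //; rewrite rmorph0 mul0r addr0.
have: line q v (q + v) by exists 1 => //; rewrite rmorph1 mul1r.
rewrite -e => -[s _ Es] -[t _ Et].
have -> : v = (s - t)%:C * u by rewrite -[v](addKr q) -Es -Et; ring.
by rewrite detZ detvv mulr0.
Qed.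

Lemma parallel_dir p q u v : parallel (line p u) (line q v) -> det u v = 0.
Proof.
move=> [p' [q' [d [d0 e1 e2]]]].
have /(det_eq0P d0) [k ->] : det d u = 0 by apply: line_eq_dir (esym e1).
have /(det_eq0P d0) [l ->] : det d v = 0 by apply: line_eq_dir (esym e2).
by rewrite detZ detC detZ detvv !mulr0 oppr0 mulr0.
Qed.

End Lines.

(** * Midpoints and parallels in a closed pair *)

Section ClosedPair.
Variables (R : realType) (S : set R[i]) (L : set (set R[i])).
Hypothesis SL : thalian_closed S L.
Implicit Types (p q u v w x y z : R[i]) (r s t k : R).

(** A nonzero determinant rules out equal as well as parallel lines, as the intersection axiom
    requires. *)
Lemma meet_lines p q u v x s t : L (line p u) -> L (line q v) ->
  det u v != 0 -> x = p + s%:C * u -> x = q + t%:C * v -> S x.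
Proof.
case: SL => _ _ S2 _ Lu Lv uv xu xv; apply: S2 Lu Lv _ _ _ _.
- by move=> /line_eq_dir/eqP; rewrite (negPf uv).
- by move=> /parallel_dir/eqP; rewrite (negPf uv).
- by exists s.
- by exists t.
Qed.

Lemma line_closed p q : S p -> S q -> q - p != 0 -> L (line p (q - p)).
Proof.
case: SL => _ S1 _ _ Sp Sq pq; apply: S1 => // e.
by rewrite e subrr eqxx in pq.
Qed.

Lemma det_neq0 u v : det u v != 0 -> u != 0 /\ v != 0.
Proof.
by move=> uv; split; apply: contraNneq uv => ->; rewrite /det /=; apply/eqP; ring.
Qed.

Lemma meet p q x u v s t : S p -> S q -> S u -> S v ->
  det (q - p) (v - u) != 0 -> x = p + s%:C * (q - p) -> x = u + t%:C * (v - u) ->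
  S x.
Proof.
move=> Sp Sq Su Sv D; have [qp vu] := det_neq0 D.
by apply: meet_lines D; apply: line_closed.
Qed.

(** The line through [p] and [q] meets their perpendicular bisector here; the determinant is the
    squared length of the segment. *)
Lemma midpoint_closed p q : S p -> S q -> S ((p + q) / 2).
Proof.
move=> Sp Sq; have [->|/eqP pq] := eqVneq p q.
  by have -> : (q + q) / 2 = q by field.
case: (SL) => _ S1 _ S3.
apply: (@meet_lines _ _ _ _ _ 2^-1 0 (S1 _ _ Sp Sq pq) (S3 _ _ Sp Sq pq)).
- have: q - p != 0 by rewrite subr_eq0 eq_sym; apply/eqP.
  case: (q - p) => a b; rewrite eq_complex /= /det /= => h.
  have -> : a * (0 * b + 1 * a) - b * (0 * a - 1 * b) = a ^+ 2 + b ^+ 2 by ring.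
  by rewrite paddr_eq0 ?sqr_ge0 // !sqrf_eq0.
- by field.
- by rewrite rmorph0; ring.
Qed.

(* The classical ruler construction of a parallel to a segment with known
   midpoint, started at the point dividing the segment from a to p as 1 : 3. *)
Lemma ruler_parallel a b p : S a -> S b -> S p -> det (b - a) (p - a) != 0 ->
  S (p - 3 * (b - a)).
Proof.
move=> Sa Sb Sp D.
have Sc := midpoint_closed Sa (midpoint_closed Sa Sp).
have Sm := midpoint_closed Sa Sb.
set c := (a + _) / 2 in Sc; set m := (a + b) / 2 in Sm.
have Ec : c = a + (4^-1)%:C * (p - a) by rewrite /c; field.
have Em : m = a + (2^-1)%:C * (b - a) by rewrite /m; field.
(* [x] is where the line [c m] meets the line [p b]; afterwards [a x] meets [b c] in the target
   point. *)
pose x := a + (3 / 2)%:C * (b - a) - (2^-1)%:C * (p - a).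
have Sx : S x.
  apply: (@meet c m x p b 3 (3 / 2)) => //; last 2 first.
  - by rewrite /x Ec Em; field.
  - by rewrite /x; field.
  have -> : det (m - c) (b - p) = - 4^-1 * det (b - a) (p - a).
    rewrite Ec Em; case: (a) (b) (p) => [a1 a2] [b1 b2] [p1 p2].
    by rewrite /det /=; field.
  by rewrite mulf_neq0 // oppr_eq0 invr_eq0 pnatr_eq0.
apply: (@meet a x _ b c (-2) 4) => //; last 2 first.
- by rewrite /x; field.
- by rewrite Ec; field.
have -> : det (x - a) (c - b) = - (8^-1) * det (b - a) (p - a).
  rewrite /x Ec; case: (a) (b) (p) => [a1 a2] [b1 b2] [p1 p2].
  by rewrite /det /=; field.
by rewrite mulf_neq0 // oppr_eq0 invr_eq0 pnatr_eq0.
Qed.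

(** To draw the parallel through [p], a second point on it is needed; its distance does not matter,
    so [k] stays unspecified. *)
Lemma parallel_point a b p : S a -> S b -> S p -> b - a != 0 ->
  exists2 k, k != 0 & S (p + k%:C * (b - a)).
Proof.
move=> Sa Sb Sp ab; have [D|D] := eqVneq (det (b - a) (p - a)) 0; last first.
  exists (-3); first by rewrite oppr_eq0 pnatr_eq0.
  have -> : p + (-3)%:C * (b - a) = p - 3 * (b - a) by ring.
  exact: ruler_parallel.
have [c Ec] := det_eq0P ab D.
have Ep : p = a + c%:C * (b - a) by rewrite -Ec; ring.
(* With [p] on the line [a b], the second point is [b] if [p = a], and [a] otherwise. *)
have [c0|c0] := eqVneq c 0.
  exists 1; rewrite ?oner_eq0 //.
  by rewrite Ep c0 rmorph0 rmorph1 mul0r addr0 mul1r addrC subrK.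
exists (- c); rewrite ?oppr_eq0 // Ep.
by have -> : a + c%:C * (b - a) + (- c)%:C * (b - a) = a by ring.
Qed.

(** Lines given by a base point and a direction can now be intersected; the unknown scales are
    absorbed into the parameters. *)
Lemma meet_parallels a b p c d q x s t : S a -> S b -> S p -> S c -> S d -> S q ->
  det (b - a) (d - c) != 0 ->
  x = p + s%:C * (b - a) -> x = q + t%:C * (d - c) -> S x.
Proof.
move=> Sa Sb Sp Sc Sd Sq D xp xq; have [ab cd] := det_neq0 D.
have [k k0 Sk] := parallel_point Sa Sb Sp ab.
have [l l0 Sl] := parallel_point Sc Sd Sq cd.
apply: (@meet p _ x q _ (s / k) (t / l) Sp Sk Sq Sl).
- by rewrite ![_ + _ - _]addrAC !subrr !add0r detZ detC detZ -mulrN -detC !mulf_neq0.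
- by rewrite addrAC subrr add0r mulrA -rmorphM divfK.
- by rewrite addrAC subrr add0r mulrA -rmorphM divfK.
Qed.

End ClosedPair.

(** * Arithmetic of the points of a pair containing 0, 1 and z *)

Section GeneratedPoints.
Variables (R : realType) (S : set R[i]) (L : set (set R[i])) (z : R[i]).
Hypotheses (SL : thalian_pair z S L) (z_im : complex.Im z != 0).
Implicit Types (p q u v w : R[i]) (r s t x y : R).

Let SL_closed : thalian_closed S L. Proof. by case: SL. Qed.
Let S0 : S 0. Proof. by case: SL. Qed.
Let S1 : S 1. Proof. by case: SL. Qed.
Let Sz : S z. Proof. by case: SL. Qed.

(** Since [1] and [z] are independent over the reals, a nonzero [p] cannot be proportional to
    both. *)
Lemma exists_independent p : p != 0 -> exists2 s, S s & det p s != 0.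
Proof.
move=> p0; have [D|D] := eqVneq (det p 1) 0; last by exists 1.
exists z => //; have [k Ek] := det_eq0P p0 D.
apply: contra_neq z_im => Dz; rewrite -det1 Ek detC detZ detC Dz.
by rewrite oppr0 mulr0 oppr0.
Qed.

(** For independent vectors the difference completes a parallelogram; dependent ones are handled
    through an auxiliary point [s] off their line. *)
Lemma sub_closed p q : S p -> S q -> S (p - q).
Proof.
have indep u v : S u -> S v -> det u v != 0 -> S (u - v).
  move=> Su Sv D.
  apply: (@meet_parallels _ _ _ SL_closed 0 v u v u 0 _ (-1) 1) => //.
  - by rewrite subr0 detB detvv subr0 detC oppr_eq0.
  - by ring.
  - by ring.
move=> Sp Sq; have [->|q0] := eqVneq q 0; first by rewrite subr0.
have [D|D] := eqVneq (det q p) 0; last first.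
  by apply: indep => //; rewrite detC oppr_eq0.
have [k Ek] := det_eq0P q0 D; have [s Ss Ds] := exists_independent q0.
have Sw : S (s - q) by apply: indep => //; rewrite detC oppr_eq0.
(* The parallel to [s p] through [s - q] meets the line [0 q] in [p - q]. *)
apply: (@meet_parallels _ _ _ SL_closed 0 q 0 s p (s - q) _ (k - 1) 1) => //.
- by rewrite subr0 detB D sub0r oppr_eq0.
- by rewrite Ek; ring.
- by ring.
Qed.

Lemma add_closed p q : S p -> S q -> S (p + q).
Proof.
by move=> Sp Sq; rewrite -[q]opprK -[- q]sub0r; do 2!apply: sub_closed => //.
Qed.

Lemma meet_real p u v x k : S p -> S u -> S v -> complex.Im (v - u) != 0 ->
  x%:C = p + k%:C * (v - u) -> S x%:C.
Proof.
move=> Sp Su Sv D E.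
apply: (@meet_parallels _ _ _ SL_closed 0 1 0 u v p _ x k) => //.
- by rewrite subr0 det1.
- by ring.
Qed.

(** Intercept theorem: the parallel to the line [1 p] through [x] meets the line [0 p] in [x p]. *)
Lemma scale_closed x p : S x%:C -> S p -> complex.Im p != 0 -> S (x%:C * p).
Proof.
move=> Sx Sp D; apply: (@meet_parallels _ _ _ SL_closed 0 p 0 1 p x%:C _ x x) => //.
- by rewrite subr0 detB detvv sub0r detC opprK det1.
- by ring.
- by ring.
Qed.

Lemma real_mul_closed x y : S x%:C -> S y%:C -> S (x * y)%:C.
Proof.
move=> Sx Sy; have Sxz := scale_closed Sx Sz z_im.
(* The parallel to the line [z y] through [x z] meets the real axis in [x y]. *)
apply: (@meet_real (x%:C * z) z y%:C _ x) => //; last by rewrite rmorphM; ring.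
by case: (z) z_im => a b /=; rewrite sub0r oppr_eq0.
Qed.

Lemma real_inv_closed x : S x%:C -> S (x^-1)%:C.
Proof.
have [->|x0] := eqVneq x 0; first by rewrite invr0.
move=> Sx; have Sxz := scale_closed Sx Sz z_im.
(* The parallel through [z] to the line from [x z] to [1] meets the real axis in [x^-1]. *)
apply: (@meet_real z (x%:C * z) 1 _ x^-1) => //; last by field; rewrite fmorph_eq0.
case: (z) z_im => a b /= b0.
have -> : 0 - (x * b + 0 * a) = - (x * b) by ring.
by rewrite oppr_eq0 mulf_neq0.
Qed.

(** Projecting [w] along [p] to the real axis gives [s]; projecting [w - s = t p] along [1 - p]
    gives [t]. *)
Lemma real_coordinates p w : S p -> complex.Im p != 0 -> S w ->
  exists s t, [/\ S s%:C, S t%:C & w = s%:C + t%:C * p].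
Proof.
move=> Sp D Sw; pose t := complex.Im w / complex.Im p.
pose s := complex.Re w - t * complex.Re p.
have E : w = s%:C + t%:C * p.
  rewrite /s /t; case: (w) (p) D => [a b] [c d] /= d0.
  by by_parts; field.
have Ss : S s%:C.
  apply: (@meet_real w 0 p _ (- t)) => //; first by rewrite subr0.
  by rewrite E; ring.
exists s, t; split => //.
apply: (@meet_real (w - s%:C) p 1 _ t) => //; first exact: sub_closed.
  by case: (p) D => c d /=; rewrite sub0r oppr_eq0.
by rewrite E; ring.
Qed.

(** This is the circumcentre of 0, [r], [p], the meeting point of the bisectors of the two sides at
    0. *)
Lemma circumcenter_closed r p : r != 0 -> S r%:C -> S p -> complex.Im p != 0 ->
  S ((r / 2) +i* ((complex.Re p ^+ 2 + complex.Im p ^+ 2 - complex.Re p * r) /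
                  (2 * complex.Im p))).
Proof.
move=> r0 Sr Sp D; case: SL_closed => _ _ _ S3.
have ne u : complex.Re u != 0 \/ complex.Im u != 0 -> 0 <> u.
  by move=> h e; move: h; rewrite -e /= eqxx => -[].
have Lr := S3 _ _ S0 Sr (ne r%:C (or_introl r0)).
have Lp := S3 _ _ S0 Sp (ne p (or_intror D)).
case: (p) Sp D Lp => a b /= Sp D Lp.
apply: (@meet_lines _ _ _ SL_closed _ _ _ _ _
  ((a ^+ 2 + b ^+ 2 - a * r) / (2 * b * r)) ((a - r) / (2 * b)) Lr Lp).
- rewrite /det /=.
  have -> : (0 * (r - 0) - 1 * (0 - 0)) * (0 * (b - 0) + 1 * (a - 0)) -
     (0 * (0 - 0) + 1 * (r - 0)) * (0 * (a - 0) - 1 * (b - 0)) = r * b by ring.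
  exact: mulf_neq0.
- have -> : (0 + r%:C) / 2 = (r / 2)%:C :> R[i] by field.
  by by_parts; field; rewrite ?D ?r0.
- rewrite (_ : (0 + _) / 2 = (2^-1)%:C * (a +i* b)); last by field.
  by by_parts; field.
Qed.

(** In the sum of the circumcentres for [r = 1] and [r = -1] the terms odd in [r] cancel. *)
Lemma norm_over_Im_closed p : S p -> complex.Im p != 0 ->
  S (0 +i* ((complex.Re p ^+ 2 + complex.Im p ^+ 2) / complex.Im p)).
Proof.
move=> Sp D; have SN1 : S (-1)%:C by rewrite rmorphN1 -[-1]sub0r; exact: sub_closed.
have N0 : -1 != 0 :> R by rewrite oppr_eq0 oner_eq0.
apply: (eq_ind _ S (add_closed (circumcenter_closed (oner_neq0 R) S1 Sp D)
                               (circumcenter_closed N0 SN1 Sp D))).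
by case: (p) D => a b /= D; by_parts; field.
Qed.

Lemma Im_closed : S (0 +i* complex.Im z).
Proof.
have := norm_over_Im_closed Sz z_im; set h := (X in 0 +i* X) => Sh.
have h0 : h != 0.
  rewrite mulf_neq0 ?invr_eq0 // gt_eqF // ltr_wpDl ?sqr_ge0 //.
  by rewrite exprn_even_gt0.
(* The vertical direction [i h] projects [z] onto the real axis. *)
have Sa : S (complex.Re z)%:C.
  apply: (@meet_real z 0 (0 +i* h) _ (- (complex.Im z / h))) => //.
    by rewrite subr0.
  by case: (z) => a b /=; by_parts; field.
apply: (eq_ind _ S (sub_closed Sz Sa)); case: (z) => a b /=; by_parts; ring.
Qed.

Lemma Re_closed : S (complex.Re z)%:C.
Proof.
apply: (eq_ind _ S (sub_closed Sz Im_closed)); case: (z) => a b /=; by_parts; ring.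
Qed.

Lemma imaginary_coordinates w : S w ->
  S (complex.Re w)%:C /\ S (complex.Im w / complex.Im z)%:C.
Proof.
move=> /(real_coordinates Im_closed z_im) [s [t [Ss St ->]]] /=.
have -> : s + (t * 0 - 0 * complex.Im z) = s by ring.
by have -> : (0 + (t * complex.Im z + 0 * 0)) / complex.Im z = t by field.
Qed.

Lemma Im_sqr_closed : S (complex.Im z ^+ 2)%:C.
Proof.
(* With [b = Im z], the point [b i] itself would only return [b i]; the shift by 1 yields
   [(1 + b^-2) b i], whence [b^2] by subtracting 1 and inverting. *)
have := norm_over_Im_closed (add_closed S1 Im_closed); rewrite /= add0r addr0.
move=> /(_ z_im) /imaginary_coordinates [_ /=] Sq.
have /real_inv_closed : S ((1 ^+ 2 + complex.Im z ^+ 2) / complex.Im z /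
                           complex.Im z - 1)%:C.
  by rewrite rmorphB; apply: sub_closed.
rewrite (_ : _ - 1 = (complex.Im z ^+ 2)^-1) ?invrK //.
by field.
Qed.

End GeneratedPoints.

(** * Subfields given as sets, and generation *)

Section Subfields.
Variable F : fieldType.
Implicit Types (K A : set F) (x y : F).

(** Passes from boolean membership to plain predicates; as [x / 0 = 0], closure under division needs
    no side condition. *)
Lemma is_subfieldP K : is_subfield K <->
  [/\ K 1, forall x y, K x -> K y -> K (x - y)
    & forall x y, K x -> K y -> K (x / y)].
Proof.
split=> [[K1 KB Kdiv]|[K1 KB Kdiv]].
  split=> [|x y Kx Ky|x y Kx Ky]; first by rewrite inE in K1.
    by have := KB x y; rewrite !inE; apply.
  by have := Kdiv x y; rewrite !inE; apply.
split=> [|x y|x y]; rewrite ?inE //; [exact: KB | exact: Kdiv].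
Qed.

Section Closure.
Variables (K : set F) (subK : is_subfield K).

Lemma subfield1 : K 1. Proof. by case/is_subfieldP: subK. Qed.

Lemma subfieldB x y : K x -> K y -> K (x - y).
Proof. by case/is_subfieldP: subK => _ KB _; exact: KB. Qed.

Lemma subfield0 : K 0.
Proof. by rewrite -(subrr 1); apply: subfieldB subfield1 subfield1. Qed.

Lemma subfieldN x : K x -> K (- x).
Proof. by rewrite -sub0r; apply: subfieldB subfield0. Qed.

Lemma subfieldD x y : K x -> K y -> K (x + y).
Proof.
by move=> Kx Ky; rewrite -[y]opprK; apply: subfieldB => //; exact: subfieldN.
Qed.

Lemma subfield_div x y : K x -> K y -> K (x / y).
Proof. by case/is_subfieldP: subK => _ _ Kdiv; exact: Kdiv. Qed.

Lemma subfieldV x : K x -> K x^-1.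
Proof. by rewrite -div1r; apply: subfield_div subfield1. Qed.

Lemma subfieldM x y : K x -> K y -> K (x * y).
Proof.
by move=> Kx Ky; rewrite -[y]invrK; apply: subfield_div => //; exact: subfieldV.
Qed.

End Closure.

Lemma field_gen_subfield A : is_subfield (field_gen A).
Proof.
apply/is_subfieldP; split=> [B [/subfield1 ? _] //|x y hx hy B hB|x y hx hy B hB].
- by apply: subfieldB; [case: hB | exact: hx | exact: hy].
- by apply: subfield_div; [case: hB | exact: hx | exact: hy].
Qed.

Lemma sub_field_gen A : A `<=` field_gen A.
Proof. exact: sub_smallest. Qed.

Lemma field_gen_sub A K : is_subfield K -> A `<=` K -> field_gen A `<=` K.
Proof. by move=> subK AK; apply: smallest_sub. Qed.

End Subfields.

(** * The model K + K b i and its closure under the axioms *)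

Section CoordinateField.
Variables (R : realType) (K : set R) (b : R).
Hypotheses (subK : is_subfield K) (b0 : b != 0) (Kb2 : K (b ^+ 2)).
Implicit Types (p d u v w : R[i]).

Let KB := subfieldB subK.
Let KD := subfieldD subK.
Let KM := subfieldM subK.
Let KN := subfieldN subK.
Let KV := subfieldV subK.
Let K1 := subfield1 subK.
Let K0 := subfield0 subK.

Definition coord_points : set R[i] :=
  [set w | K (complex.Re w) /\ K (complex.Im w / b)].

Definition coord_lines : set (set R[i]) :=
  [set l | exists p d, [/\ coord_points p, coord_points d, d != 0 & l = line p d]].

Lemma line_scale p d (k : R) : k != 0 -> line p (k%:C * d) = line p d.
Proof.
move=> k0; apply/seteqP; split=> _ [t _ <-].
  by exists (t * k) => //; rewrite rmorphM mulrA.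
by exists (t / k) => //; rewrite mulrA -rmorphM divfK.
Qed.

Lemma coord_sub u v : coord_points u -> coord_points v -> coord_points (u - v).
Proof.
case: u v => [a1 a2] [c1 c2] [/= ? ?] [/= ? ?]; split=> /=; first exact: KB.
by rewrite mulrBl; exact: KB.
Qed.

Lemma coord_add u v : coord_points u -> coord_points v -> coord_points (u + v).
Proof.
case: u v => [a1 a2] [c1 c2] [/= ? ?] [/= ? ?]; split=> /=; first exact: KD.
by rewrite mulrDl; exact: KD.
Qed.

Lemma coord_scale (x : R) u : K x -> coord_points u -> coord_points (x%:C * u).
Proof.
case: u => [a1 a2] Kx [/= ? ?]; split=> /=.
  by rewrite mul0r subr0; exact: KM.
by rewrite mul0r addr0 -mulrA; exact: KM.
Qed.

(** Multiply by the conjugate of [v]: with [t = c2 / b], the norm [c1^2 + t^2 b^2] lies in [K]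
    because [b^2] does. *)
Lemma coord_div u v : coord_points u -> coord_points v -> coord_points (u / v).
Proof.
case: u v => [a1 a2] [c1 c2] [/= h1 h2] [/= h3 h4].
have Ea : a2 = a2 / b * b by rewrite divfK.
have Ec : c2 = c2 / b * b by rewrite divfK.
move: (a2 / b) (c2 / b) Ea Ec h2 h4 => s t -> -> Ks Kt.
have := KV (KD (KM h3 h3) (KM (KM Kt Kt) Kb2)).
rewrite (_ : _ + _ = c1 ^+ 2 + (t * b) ^+ 2); last by ring.
rewrite /coord_points /=; set n := _^-1 => Kn; split.
  rewrite (_ : _ - _ = (a1 * c1 + s * t * b ^+ 2) * n); last by ring.
  by apply: (KM _ Kn); apply: KD; [exact: KM | apply: (KM _ Kb2); exact: KM].
rewrite (_ : _ / b = (s * c1 - a1 * t) * n); last by field.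
by apply: (KM _ Kn); apply: KB; exact: KM.
Qed.

Lemma coord_subfield : is_subfield coord_points.
Proof.
apply/is_subfieldP; split; [|exact: coord_sub|exact: coord_div].
by split; rewrite /= ?mul0r.
Qed.

(** Each term of the determinant carries exactly one factor [b], so quotients of determinants lie in
    [K]. *)
Lemma coord_det u v : coord_points u -> coord_points v -> K (det u v / b).
Proof.
case: u v => [a1 a2] [c1 c2] [/= ? ?] [/= ? ?]; rewrite /det /=.
rewrite (_ : _ / b = a1 * (c2 / b) - a2 / b * c1); last by ring.
by apply: KB; apply: KM.
Qed.

Lemma coord_closed : thalian_closed coord_points coord_lines.
Proof.
have E2 : 2 != 0 :> R by rewrite pnatr_eq0.
have ne p q : p <> q -> q - p != 0.
  by move=> pq; rewrite subr_eq0; apply/eqP => /esym.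
split.
- by move=> _ [p [d [_ _ d0 ->]]]; exists p, d.
- move=> p q Sp Sq /ne pq; exists p, (q - p); split=> //; exact: coord_sub.
- move=> _ _ w [p [d [Sp Sd d0 ->]]] [q [e [Sq Se e0 ->]]] _ npar.
  move=> [s _ Es] [t _ Et].
  have D : det d e != 0.
    apply/eqP => /(det_eq0P d0) [k Ek]; apply: npar; exists p, q, d; split=> //.
    rewrite Ek line_scale //; apply: contraNneq e0 => k0.
    by rewrite Ek k0 rmorph0 mul0r.
  (* Cramer's rule for the parameter of the intersection point. *)
  have Ds : s * det d e = det (q - p) e.
    have -> : q - p = s%:C * d - t%:C * e.
      by rewrite -[q](addrK (t%:C * e)) Et -Es; ring.
    by rewrite detBl ![det (_ * _) _]detC !detZ detvv [det d e]detC; ring.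
  rewrite -Es; apply: coord_add => //; apply: coord_scale => //.
  have -> : s = det (q - p) e / b / (det d e / b).
    by rewrite -Ds; field; rewrite D b0.
  by apply: KM; [|apply: KV]; apply: coord_det => //; exact: coord_sub.
- move=> p q Sp Sq /ne pq; have Spq := coord_sub Sq Sp.
  (* The rotated direction may leave the model; the real factor [b] brings it back without changing
     the line. *)
  exists ((p + q) / 2), (b%:C * ((0 +i* 1) * (q - p))); split.
  + have -> : (p + q) / 2 = (2^-1)%:C * (p + q) by field.
    apply: coord_scale; last exact: coord_add.
    by apply: KV; exact: (KD K1 K1).
  + case: (q - p) Spq => a c [/= Ka Kc]; split=> /=.
      rewrite (_ : _ - _ = - (c / b * b ^+ 2)); last by field.
      by apply: KN; apply: KM.
    by rewrite (_ : _ / b = a) //; field.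
  + by rewrite !mulf_neq0 ?fmorph_eq0 // eq_complex /= oner_eq0 andbF.
  + by rewrite line_scale.
Qed.

End CoordinateField.

Theorem theorem2p11 (R : realType) (z : R[i]) (a b : R)
    (hz : z = a +i* b) (z_nonreal : z \isn't Num.real) :
  let XC : set R[i] := [set x%:C | x in real_parts z] in
  [/\ field_ext_degree XC (Pi z) 2 /\ Pi z = adjoin XC (0 +i* b),
      is_subfield (real_parts z) /\
        XC = Pi z `&` [set x%:C | x in [set: R]],
      real_parts z = field_gen [set a; b ^+ 2] \/
        real_parts z = field_gen [set a; b]
    & Thalian z <-> field_gen [set a; b ^+ 2] b].
Proof.
have b0 : b != 0 by move: z_nonreal; rewrite hz complex_real.
have z_im : complex.Im z != 0 by rewrite hz.
have zP := Pi_pair z.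
set K := field_gen [set a; b ^+ 2].
have subK : is_subfield K := field_gen_subfield _.
have Ka : K a by apply: sub_field_gen; left.
have Kb2 : K (b ^+ 2) by apply: sub_field_gen; right.
(* The reals in [Pi z] form a subfield containing the generators [a] and [b^2] of [K]. *)
have Pi_real x : K x -> Pi z x%:C.
  apply: (@field_gen_sub _ _ [set y | Pi z y%:C]).
    apply/is_subfieldP; split=> [|x1 y Px Py|x1 y Px Py] /=; first by case: zP.
      by rewrite rmorphB; exact: (sub_closed zP z_im).
    by apply: (real_mul_closed zP z_im) => //; exact: (real_inv_closed zP z_im).
  move=> _ [->|->] /=; first by have := Re_closed zP z_im; rewrite hz.
  by have := Im_sqr_closed zP z_im; rewrite hz.
have PiE : Pi z = coord_points K b.
  apply/seteqP; split.
    (* Minimality of [Pi z] against the coordinate pair. *)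
    apply: (Pi_least (S := coord_points K b) (L := coord_lines K b) _).1; split.
    - exact: coord_closed.
    - by apply: subfield0; exact: coord_subfield.
    - by apply: subfield1; exact: coord_subfield.
    - by rewrite hz; split=> //=; rewrite divff //; exact: subfield1.
  case=> c d [/= Kc Kd].
  have -> : c +i* d = c%:C + (d / b)%:C * (0 +i* b) by by_parts; field.
  apply: (add_closed zP z_im); first exact: Pi_real.
  apply: (scale_closed zP) => //; first exact: Pi_real.
  by have := Im_closed zP z_im; rewrite hz.
have partsE : real_parts z = K.
  rewrite /real_parts PiE; apply/seteqP; split=> [_ [w [Kw _] <-] //|x Kx].
  by exists x%:C => //; split=> //=; rewrite mul0r; exact: subfield0.
have subPi : is_subfield (Pi z) by rewrite PiE; exact: coord_subfield.
move=> XC; have XCE : XC = Pi z `&` [set x%:C | x in [set: R]].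
  rewrite /XC partsE; apply/seteqP; split=> [_ [x Kx <-]|w [Pw [x _ Ex]]].
    by split; [exact: Pi_real | exists x].
  by move: Pw; rewrite -Ex PiE => -[/= Kx _]; exists x.
have XC_real x : K x -> XC x%:C by move=> Kx; exists x; rewrite ?partsE.
have Pib : Pi z (0 +i* b).
  by rewrite PiE; split=> /=; rewrite ?divff //; [exact: subfield0|exact: subfield1].
have Pi_coord w : Pi z w -> exists x y, [/\ K x, K y & w = x%:C + y%:C * (0 +i* b)].
  rewrite PiE; case: w => c d [/= Kc Kd]; exists c, (d / b); split=> //.
  by by_parts; field.
have XCPi : XC `<=` Pi z by rewrite XCE => w [].
split.
- split.
    split=> //.
      rewrite XCE; apply/is_subfieldP; split.
      + by split; [exact: subfield1 | exists 1].
      + move=> u v [Pu [x _ Ex]] [Pv [y _ Ey]]; split; first exact: (subfieldB subPi).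
        by exists (x - y) => //; rewrite -Ex -Ey rmorphB.
      + move=> u v [Pu [x _ Ex]] [Pv [y _ Ey]]; split; first exact: (subfield_div subPi).
        by exists (x / y) => //; rewrite -Ex -Ey fmorph_div.
    (* The basis is [1], [b i]; comparing real and imaginary parts gives independence. *)
    exists (fun i : 'I_2 => if i == ord0 then 1 else 0 +i* b); split.
    + move=> c Kc; rewrite big_ord_recl big_ord1 /= mulr1; apply: (subfieldD subPi).
        exact: XCPi.
      by apply: (subfieldM subPi) => //; exact: XCPi.
    + move=> w /Pi_coord [x [y [Kx Ky ->]]].
      exists (fun i : 'I_2 => if i == ord0 then x%:C else y%:C).
        by move=> i; case: ifP => _; exact: XC_real.
      by rewrite big_ord_recl big_ord1 /= mulr1.
    + move=> c Kc; rewrite big_ord_recl big_ord1 /= mulr1.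
      have [x _ Ex] := Kc ord0; have [y _ Ey] := Kc (lift ord0 ord0).
      rewrite -Ex -Ey => /eqP; rewrite eq_complex /= => /andP[/eqP h1 /eqP h2].
      have y0 : y = 0.
        by apply: (mulIf b0); rewrite mul0r -[RHS]h2; ring.
      have x0 : x = 0 by rewrite -[RHS]h1; ring.
      move=> i; have [->|] := eqVneq i ord0; first by rewrite -Ex x0.
      case: (unliftP ord0 i) => [j ->|-> /eqP //] _.
      by rewrite (ord1 j) -Ey y0.
  apply/seteqP; split.
    move=> w /Pi_coord [x [y [Kx Ky ->]]] B [subB hB].
    apply: (subfieldD subB); first by apply: hB; left; exact: XC_real.
    apply: (subfieldM subB); apply: hB; first by left; exact: XC_real.
    by right.
  by apply: field_gen_sub => // w [/XCPi|->].
- by split => //; rewrite partsE.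
- by left.
(* The point i has coordinates 0 and [1 / b], and [1 / b] lies in [K] exactly when [b] does. *)
- rewrite /Thalian PiE; split=> [[_ [/= _]]|Kb].
    by rewrite div1r => /(subfieldV subK); rewrite invrK.
  split=> //; split=> /=; first exact: (subfield0 subK).
  by rewrite div1r; exact: (subfieldV subK).
Qed.
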